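(* For any $r,m,n\in\mathbb N$ and each partition $X=\{x_j\}_{j=0}^n$ of $[-1,1]$, there is a convex function $f\in C^r[-1,1]$ such that for every convex $s\in S(X,m)$ and every function $\psi$ which is positive on $(-1,1)$ and satisfies $\lim_{x\to\pm1}\psi(x)=0$, either $$\limsup_{x\to-1}\frac{|f(x)-s(x)|}{\varphi^2(x)\psi(x)}=\infty\quad\text{or}\quad\limsup_{x\to1}\frac{|f(x)-s(x)|}{\varphi^2(x)\psi(x)}=\infty .$$
   Context: $C^r[-1,1]$ is the space of $r$ times continuously differentiable functions on $[-1,1]$, and $\varphi(x)=\sqrt{1-x^2}$. A partition $X=\{x_j\}_{j=0}^n$ of $[-1,1]$ means $-1=x_0<x_1<\dots<x_n=1$. For $m\in\mathbb N$, $S(X,m)$ denotes the set of continuous functions on $[-1,1]$ which on each interval $[x_{j-1},x_j]$, $1\le j\le n$, coincide with an algebraic polynomial of degree $\le m-1$. The limits superior are taken over $x\in(-1,1)$, and ''or'' is inclusive. *)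

(* Defs.v *)
From mathcomp Require Import all_boot all_order all_algebra.
From mathcomp Require Import all_classical all_reals all_analysis.

Set Implicit Arguments.
Unset Strict Implicit.
Unset Printing Implicit Defensive.

Import Order.TTheory GRing.Theory Num.Theory.
Import numFieldNormedType.Exports.

Local Open Scope classical_set_scope.
Local Open Scope ring_scope.

(* Functions on [-1, 1] are total functions R -> R; every notion below depends
   only on their values on [-1, 1]. *)

Section Defs.
Variable R : realType.
Implicit Types (f g s : R -> R) (X : seq R).

Definition varphi (x : R) : R := Num.sqrt (1 - x ^+ 2).

(* The difference quotient is restricted to [-1, 1], so that g (-1) and g 1
   are the one-sided derivatives of f. *)
Definition has_derivative_on f g : Prop :=
  forall x, x \in `[-1, 1] ->
    (f y - f x) / (y - x) @[y --> within `[-1, 1] x^'] --> g x.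

Fixpoint Cr (r : nat) f : Prop :=
  match r with
  | 0 => {within `[-1, 1], continuous f}
  | r'.+1 => exists g, has_derivative_on f g /\ Cr r' g
  end.

Definition convex_on f : Prop := convex_function (`[-1, 1] : set R^o) f.

(* The point -1 is not listed in X: with n = size X, x_0 = -1 and
   X = [:: x_1; ...; x_n]. *)
Definition is_partition X : Prop := itv_partition (-1) 1 X.

Definition node X (j : nat) : R := nth 1 (-1 :: X) j.

(* [size p <= m] is degree at most m - 1. *)
Definition spline_space X (m : nat) : set (R -> R) :=
  [set s : R -> R | {within `[-1, 1], continuous s} /\
    forall j, (j < size X)%N ->
      exists p : {poly R}, (size p <= m)%N /\
        forall x, x \in `[node X j, node X j.+1] -> s x = p.[x]].

End Defs.

(* Main.v *)
Require Import Defs.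
From mathcomp Require Import all_boot all_order all_algebra.
From mathcomp Require Import all_classical all_reals all_analysis.
From mathcomp Require Import ring lra qpoly.
Import Order.TTheory GRing.Theory Num.Theory.
Import numFieldNormedType.Exports.
Local Open Scope classical_set_scope.
Local Open Scope ring_scope.

(** The limits superior are only there to pin down Hermite data.  If both are
finite, then near each endpoint [c] the error is bounded by a multiple of
[|x - c| * psi x] with [psi] tending to 0, so the polynomial pieces of [s] at
the endpoints have the values and the first derivatives of [f] there
(lemma [finite_limsup_contact]).  It thus suffices to find a convex [f] whose
four numbers [f (-1)], [f' (-1)], [f 1], [f' 1] are shared by no convex spline
of the given order and knots.

Take [f x = ((x + 1) / 2) ^ N], for which these numbers are 0, 0, 1, N / 2.
A convex [s] sharing them is nonnegative, since it lies above its tangent at -1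
([convex_ge0_of_flat_end]), and at most 1, since it lies below the chord
([convex_le1]).  Hence on the last knot interval [s] is a polynomial of bounded
degree with values in [0, 1], and the derivative of such a polynomial at 1 is
at most a constant [C] that depends only on the degree and on the interval
([deriv_bound]).  With [N / 2 > C] this contradicts [s' (1) = N / 2].  The
choice of [N] involves only the order and the knots, so one [f] defeats all
[s] and [psi]; being a polynomial, it is of class [C^r] for all [r]. *)

(** * First-order behaviour of polynomials *)

(** Writing the difference quotient of [p] at [c] as a polynomial [h] turns
statements on derivatives into continuity of [h] at [c]. *)
Lemma first_order_factor {R : idomainType} (p : {poly R}) (c : R) :
  exists2 h : {poly R}, (forall x, p.[x] = p.[c] + (x - c) * h.[x]) &
    p^`().[c] = h.[c].
Proof.
have /factor_theorem[h ph] : root (p - p.[c]%:P) c.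
  by rewrite rootE !hornerE subrr.
have {}ph : p = h * ('X - c%:P) + p.[c]%:P by rewrite -ph subrK.
exists h => [x|]; rewrite {1}ph; first by rewrite !hornerE; ring.
by rewrite derivD derivM derivB derivX !derivC !hornerE; ring.
Qed.

Lemma cvg_horner {R : realType} {F : set_system R} (p : {poly R}) (c : R) :
  Filter F -> F --> c -> p.[x] @[x --> F] --> p.[c].
Proof.
by move=> FF Fc; apply: (cvg_comp _ _ Fc); exact: continuous_horner.
Qed.

Lemma Cr_horner {R : realType} (r : nat) (p : {poly R}) : Cr r (horner p).
Proof.
elim: r p => [p|r IHr p] /=.
  by apply: continuous_subspaceT => x; exact: continuous_horner.
exists (horner p^`()); split=> // x _.
have [h ph ->] := first_order_factor p x.
have hx : h.[y] @[y --> within `[-1, 1] x^'] --> h.[x].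
  apply: cvg_horner => A Ax; apply: filterS (nbhs_dnbhs Ax).
  by move=> y /= Ay _.
apply: cvg_trans hx; apply: near_eq_cvg.
rewrite near_withinE; near=> y => _.
have yx : y - x != 0 by rewrite subr_eq0; near: y; exact: nbhs_dnbhs_neq.
by rewrite (ph y) addrC addKr mulrAC mulfV ?mul1r.
Unshelve. all: by end_near.
Qed.

(** The bound forces [q] to vanish at [c] first; dividing it by [|x - c|] then
bounds the difference quotient of [q] by [e], whose limit is 0. *)
Lemma contact_order2 {R : realType} {F : set_system R} {q : {poly R}} {c : R}
    {e : R -> R} :
  ProperFilter F -> F --> c -> e x @[x --> F] --> 0 ->
  (\forall x \near F, x != c /\ `|q.[x]| <= `|x - c| * e x) ->
  q.[c] = 0 /\ q^`().[c] = 0.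
Proof.
move=> FF Fc e0 qe.
have squeeze (p : {poly R}) (u : R -> R) : u x @[x --> F] --> 0 ->
    (\forall x \near F, `|p.[x]| <= u x) -> p.[c] = 0.
  move=> u0 pu; apply: (norm_cvg_unique (cvg_horner p _ _ Fc)).
  apply: (@squeeze_cvgr _ _ _ _ (fun x => - u x) u) => //; last first.
    by rewrite -oppr0; exact: cvgN.
  by apply: filterS pu => x; rewrite ler_norml.
have qc : q.[c] = 0.
  apply: (squeeze q (fun x => `|x - c| * e x)); last first.
    by apply: filterS qe => x [].
  rewrite -(mul0r 0); apply: cvgM e0.
  rewrite -(normr0 R) -[X in `|X|](subrr c); apply: cvg_norm.
  by apply: cvgB => //; exact: cvg_cst.
split=> //; have [h qh ->] := first_order_factor q c.
apply: (squeeze h e e0); apply: filterS qe => x [xc].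
by rewrite qh qc add0r normrM ler_pM2l// normr_gt0 subr_eq0.
Qed.

(** * From a finite limit superior to contact at an endpoint *)

Lemma limf_esup_bounded {R : realType} {T : choiceType} {X : filteredType T}
    {f : X -> R} {F : set_system X} : Filter F ->
  limf_esup (fun x => (f x)%:E) F != +oo%E ->
  exists M : R, \forall x \near F, f x <= M.
Proof.
move=> FF; rewrite -ltey => /ereal_inf_lt[_ [V FV <-]].
case supV: (ereal_sup _) => [M| |] // _; [exists M|exists 0];
  apply: filterS FV => x Vx; rewrite -lee_fin.
- by rewrite -supV; apply: ereal_sup_ubound; exists x.
- have : ((f x)%:E <= -oo)%E by rewrite -supV; apply: ereal_sup_ubound; exists x.
  by rewrite leeNy_eq.
Qed.

(** At an endpoint [c], where [c ^ 2 = 1], the weight [varphi x ^ 2] factors as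
[|x - c| * |x + c|] with [|x + c| <= 2]; so a bounded ratio gives an error of
the form [|x - c|] times a null function.  The filter [F] will be the one-sided
neighbourhoods of [c] inside the interval. *)
Lemma finite_limsup_contact {R : realType} {F : set_system R} {c : R}
    {s psi : R -> R} {P p : {poly R}} :
  c ^+ 2 = 1 -> ProperFilter F -> F --> c ->
  (\forall x \near F, -1 < x < 1) -> (\forall x \near F, s x = p.[x]) ->
  (forall x, x \in `]-1, 1[ -> 0 < psi x) -> psi x @[x --> F] --> 0 ->
  limf_esup (fun x => (`|P.[x] - s x| / (varphi x ^+ 2 * psi x))%:E)
    (within `]-1, 1[ (nbhs c)) != +oo%E ->
  P.[c] = p.[c] /\ P^`().[c] = p^`().[c].
Proof.
move=> c21 FF Fc FI sp psi_gt0 psi0 /limf_esup_bounded[M].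
rewrite near_withinE => /Fc fM.
have [] := @contact_order2 _ F (P - p) c (fun x => 2 * `|M| * psi x) _ Fc.
- by rewrite -(mulr0 (2 * `|M|)); apply: cvgM psi0; exact: cvg_cst.
- near=> x.
  have xI : -1 < x < 1 by near: x.
  have xI' : x \in `]-1, 1[ by rewrite in_itv.
  have x21 : 0 < 1 - x ^+ 2 by nra.
  have xc : x != c by apply: contra_eqN c21 => /eqP <-; rewrite -subr_eq0; lra.
  split=> //; rewrite hornerD hornerN.
  have <- : s x = p.[x] by near: x.
  have : `|P.[x] - s x| / (varphi x ^+ 2 * psi x) <= M.
    by move: xI'; near: x.
  have psix := psi_gt0 x xI'.
  rewrite /varphi sqr_sqrtr ?(ltW x21)// ler_pdivrMr ?mulr_gt0// => /le_trans.
  apply; have -> : 1 - x ^+ 2 = `|x - c| * `|x + c|.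
    by rewrite -normrM -(gtr0_norm x21) -normrN -c21; congr `|_|; ring.
  have cx2 : `|x + c| <= 2 by rewrite ler_norml; nra.
  rewrite -!mulrA mulrCA ler_wpM2l// !mulrA ler_wpM2r ?(ltW psix)//.
  apply: (@le_trans _ _ (`|M| * `|x + c|)).
    by rewrite ler_wpM2r// ler_norm.
  by rewrite mulrC ler_wpM2r.
by rewrite derivD derivN !hornerE => /subr0_eq-> /subr0_eq->.
Unshelve. all: by end_near.
Qed.

(** * Derivatives of bounded polynomials *)

(** A crude Markov inequality: by Lagrange interpolation at [m] nodes of
[a, b], the derivative at [c] is a fixed linear combination of values of [p]
in [a, b]. *)
Lemma deriv_bound {R : realType} (m : nat) (a b c : R) : a < b ->
  exists C : R, forall p : {poly R}, (size p <= m)%N ->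
    (forall x, a <= x <= b -> `|p.[x]| <= 1) -> p^`().[c] <= C.
Proof.
move=> ab; case: m => [|m].
  exists 0 => p; rewrite leqn0 size_poly_eq0 => /eqP-> _.
  by rewrite deriv0 horner0.
(* The lagrange basis requires a sampling sequence injective on all of nat. *)
pose x i : R := a + (b - a) / i.+1%:R.
have xinj : injective x.
  move=> i j /addrI /mulfI ij; have /ij/invr_inj/eqP : b - a != 0 by lra.
  by rewrite eqr_nat => /eqP[].
have xab i : a <= x i <= b.
  have ba0 : 0 <= b - a by rewrite subr_ge0 ltW.
  rewrite /x lerDl divr_ge0//= -lerBrDl ler_pdivrMr ?ltr0n//.
  by rewrite ler_peMr ?ler1n.
exists (\sum_(i < m.+1) `|(tnth (m.+1.-lagrange x) i : {poly R})^`().[c]|).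
move=> p sp p1; rewrite (lagrange_gen _ xinj sp)// raddf_sum/= horner_sum.
apply: ler_sum => i _; apply: le_trans (ler_norm _) _.
rewrite derivM derivC mul0r add0r hornerM hornerC normrM.
by rewrite ler_piMl// p1.
Qed.

(** * Convex functions on [-1, 1] *)

Lemma convex_onP {R : realType} (f : R -> R) :
  convex_on f <-> forall t x y, 0 <= t <= 1 -> -1 <= x <= 1 -> -1 <= y <= 1 ->
    f (t * x + (1 - t) * y) <= t * f x + (1 - t) * f y.
Proof.
split=> [fC t x y /andP[t0 t1] xI yI|fC t x y].
  have := fC (Itv01 t0 t1) x y; rewrite !inE /= !in_itv/=.
  by move/(_ xI yI).
rewrite !inE /= !in_itv/= => xI yI.
by apply: (fC t%:inum); rewrite ?ge0 ?le1.
Qed.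

(** Convexity along the segment from -1 to [y] bounds [t * s y] from below by
[s] at the point [t * (y + 1) - 1], which for small [t] is
[t * (y + 1) * h] of that point, where [h] is the difference quotient of [p]
at -1.  Dividing by [t] and letting [t] tend to 0 gives
[s y >= (y + 1) * p' (-1) = 0]. *)
Lemma convex_ge0_of_flat_end {R : realType} {s : R -> R} {p : {poly R}} {b : R} :
  convex_on s -> -1 < b -> (forall x, -1 <= x <= b -> s x = p.[x]) ->
  p.[-1] = 0 -> p^`().[-1] = 0 -> forall y, -1 <= y <= 1 -> 0 <= s y.
Proof.
move=> /convex_onP sC b1 sp p0 p'0 y yI.
have [->|yN1] := eqVneq y (-1); first by rewrite sp ?p0//; lra.
have {yN1} y1 : 0 < y + 1.
  by rewrite -[1]opprK subr_gt0 lt_neqAle eq_sym yN1; case/andP: yI.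
have [h ph p'h] := first_order_factor p (-1).
(* For small t > 0, r.[t] is s (t * (y + 1) - 1) / t. *)
pose r := (y + 1) *: (h \Po ((y + 1) *: 'X - 1)).
have rE t : r.[t] = (y + 1) * h.[t * (y + 1) - 1].
  by rewrite /r hornerZ horner_comp !hornerE (mulrC t).
have r0 : r.[0] = 0 by rewrite rE mul0r sub0r -p'h p'0 mulr0.
have r_le t : 0 < t -> t < 1 -> t * (y + 1) < b + 1 -> r.[t] <= s y.
  move=> t0 t1 tb; have ty : 0 < t * (y + 1) by rewrite mulr_gt0.
  have tI : 0 <= t <= 1 by rewrite !ltW.
  have N1I : -1 <= (-1 : R) <= 1 by lra.
  have wI : -1 <= t * (y + 1) - 1 <= b by lra.
  have N1b : -1 <= (-1 : R) <= b by rewrite lexx ltW.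
  have := sC t y (-1) tI yI N1I; rewrite (sp _ N1b) p0 mulr0 addr0.
  have -> : t * y + (1 - t) * -1 = t * (y + 1) - 1 by ring.
  rewrite (sp _ wI) ph p0 add0r opprK subrK rE -mulrA.
  by rewrite ler_pM2l.
have cr : r.[t] @[t --> (0 : R)^'+] --> r.[0].
  by apply: cvg_horner; apply: cvg_within.
rewrite -r0; apply: (cvgr_to_le cr); near=> t.
apply: r_le.
- by near: t; exact: nbhs_right_gt.
- by near: t; exact: nbhs_right_lt.
- rewrite -ltr_pdivlMr//; near: t; apply: nbhs_right_lt.
  by rewrite divr_gt0// -ltrBlDr sub0r.
Unshelve. all: by end_near.
Qed.

Lemma convex_le1 {R : realType} {s : R -> R} : convex_on s ->
  s (-1) = 0 -> s 1 = 1 -> forall y, -1 <= y <= 1 -> s y <= 1.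
Proof.
move=> /convex_onP sC s0 s1 y yI; have := sC ((y + 1) / 2) 1 (-1).
rewrite s0 s1 mulr1 mulr0 addr0.
have -> : (y + 1) / 2 + (1 - (y + 1) / 2) * -1 = y by field.
by move=> sy; apply: (le_trans (sy _ _ _)); lra.
Qed.

(** * The counterexample family *)

Definition ramp {R : realType} (N : nat) : {poly R} :=
  (2^-1 *: ('X + 1%:P)) ^+ N.

Lemma rampE {R : realType} (N : nat) (x : R) :
  (ramp N).[x] = ((x + 1) / 2) ^+ N.
Proof. by rewrite /ramp horner_exp !hornerE mulrC. Qed.

Lemma deriv_rampE {R : realType} (N : nat) (x : R) :
  (ramp N)^`().[x] = N%:R / 2 * ((x + 1) / 2) ^+ N.-1.
Proof.
rewrite /ramp deriv_exp derivZ derivD derivX derivC addr0 hornerMn hornerM.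
rewrite horner_exp !hornerE (mulrC 2^-1 (x + 1)).
by rewrite -mulr_natl mulrA.
Qed.

(** Multiplying the induction hypothesis by [t * u + (1 - t) * v] gives an upper
bound that falls short of the desired one by
[t * (1 - t) * (u - v) * (u ^ n - v ^ n)], which is nonnegative because
[x ^ n] is monotone on the nonnegative reals. *)
Lemma convex_exprn {R : realType} (n : nat) (t u v : R) :
  0 <= t <= 1 -> 0 <= u -> 0 <= v ->
  (t * u + (1 - t) * v) ^+ n <= t * u ^+ n + (1 - t) * v ^+ n.
Proof.
move=> /andP[t0 t1] u0 v0; elim: n => [|n IHn]; first by rewrite !expr0; lra.
have w0 : 0 <= t * u + (1 - t) * v.
  by rewrite addr_ge0 ?mulr_ge0 ?subr_ge0.
rewrite exprS; apply: (le_trans (ler_wpM2l w0 IHn)); rewrite !exprS.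
have mono : 0 <= (u - v) * (u ^+ n - v ^+ n).
  have [uv|vu] := leP u v.
    by apply: mulr_le0; rewrite subr_le0 ?lerXn2r.
  by apply: mulr_ge0; rewrite subr_ge0 ?lerXn2r ?(ltW vu).
have : 0 <= (t * (1 - t)) * ((u - v) * (u ^+ n - v ^+ n)).
  by apply: mulr_ge0 mono; rewrite mulr_ge0 ?subr_ge0.
rewrite -subr_ge0 => /le_trans; apply; rewrite le_eqVlt; apply/orP; left.
by apply/eqP; ring.
Qed.

Lemma convex_ramp {R : realType} (N : nat) : convex_on (horner (@ramp R N)).
Proof.
apply/convex_onP => t x y tI xI yI; rewrite !rampE.
have -> : (t * x + (1 - t) * y + 1) / 2 =
    t * ((x + 1) / 2) + (1 - t) * ((y + 1) / 2) by field.
by apply: convex_exprn => //; lra.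
Qed.

Theorem theorem2p5 (R : realType) (r m n : nat)
    (r_gt0 : (0 < r)%N) (m_gt0 : (0 < m)%N) (n_gt0 : (0 < n)%N)
    (X : seq R) (X_part : is_partition X) (X_size : size X = n) :
  exists f : R -> R, [/\ Cr r f, convex_on f &
    forall (s psi : R -> R),
      s \in spline_space X m -> convex_on s ->
      (forall x, x \in `]-1, 1[ -> 0 < psi x) ->
      psi x @[x --> (-1)^'+] --> (0 : R) -> psi x @[x --> 1^'-] --> (0 : R) ->
      limf_esup (fun x => (`|f x - s x| / (varphi x ^+ 2 * psi x))%:E)
        (within `]-1, 1[ (nbhs (-1 : R))) = +oo%E \/
      limf_esup (fun x => (`|f x - s x| / (varphi x ^+ 2 * psi x))%:E)
        (within `]-1, 1[ (nbhs (1 : R))) = +oo%E ].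
Proof.
have node_lt i j : (i < j)%N -> (j <= n)%N -> node X i < node X j.
  have [X_path _] := X_part; move=> ij jn.
  apply: (sorted_ltn_nth lt_trans) => //=; rewrite inE /= X_size ltnS//.
  exact: leq_trans (ltnW ij) jn.
have first_lt : -1 < node X 1.
  exact: (node_lt 0%N 1%N).
have last_node : node X n = 1.
  by rewrite /node -X_size (itv_partition_nth_size _ X_part).
have last_lt : node X n.-1 < 1.
  by rewrite -last_node; apply: node_lt; rewrite ?prednK.
have last_ge : -1 <= node X n.-1.
  by apply: itv_partition_nth_ge X_part; rewrite X_size prednK// ltnW.
(* C comes before N: it is determined by m and the last knot interval alone. *)
have [C Cbound] := deriv_bound m _ _ 1 last_lt.
(* The +2 makes N at least 2, so that the ramp has derivative 0 at -1. *)
pose N := (Num.bound `|2 * C|).+2.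
have CN : C < N%:R / 2.
  rewrite ltr_pdivlMr// mulrC (le_lt_trans (ler_norm _))//.
  rewrite (lt_trans (archi_boundP (normr_ge0 _)))// ltr_nat /N.
  by rewrite leqW.
exists (horner (ramp N)); split; [exact: Cr_horner|exact: convex_ramp|].
move=> s psi; rewrite inE => -[_ s_poly] s_cvx psi_gt0 psiL psiR.
apply: contrapT => /not_orP[/eqP limL /eqP limR].
have [p [_ sp]] := s_poly 0%N ltac:(by rewrite X_size).
have [q [q_size sq]] := s_poly n.-1 ltac:(by rewrite X_size prednK).
rewrite prednK// last_node in sq.
have [pL p'L] : (ramp N).[-1] = p.[-1] /\ (ramp N)^`().[-1] = p^`().[-1].
  apply: (finite_limsup_contact _ _ _ _ _ psi_gt0 psiL limL).
  - by rewrite sqrrN expr1n.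
  - exact: cvg_within.
  - near=> x; apply/andP; split; near: x; first exact: nbhs_right_gt.
    by apply: nbhs_right_lt; lra.
  - near=> x; apply: sp; rewrite in_itv/=; apply/andP; split; apply: ltW.
      by near: x; exact: nbhs_right_gt.
    by near: x; exact: nbhs_right_lt.
have [qR q'R] : (ramp N).[1] = q.[1] /\ (ramp N)^`().[1] = q^`().[1].
  apply: (finite_limsup_contact _ _ _ _ _ psi_gt0 psiR limR).
  - by rewrite expr1n.
  - exact: cvg_within.
  - near=> x; apply/andP; split; near: x; last exact: nbhs_left_lt.
    by apply: nbhs_left_gt; lra.
  - near=> x; apply: sq; rewrite in_itv/=; apply/andP; split; apply: ltW.
      by near: x; exact: nbhs_left_gt.
    by near: x; exact: nbhs_left_lt.
move: pL p'L qR q'R; rewrite !rampE !deriv_rampE addNr mul0r !expr0n/= mulr0.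
have -> : (1 + 1) / 2 = 1 :> R by field.
rewrite !expr1n mulr1 => /esym pL /esym p'L /esym qR /esym q'R.
have s0 : s (-1) = 0 by rewrite sp// in_itv/= lexx ltW.
have s1 : s 1 = 1 by rewrite sq// in_itv/= lexx ltW.
have s_ge0 := convex_ge0_of_flat_end s_cvx first_lt
  (fun x xI => sp x ltac:(by rewrite in_itv)) pL p'L.
have s_le1 := convex_le1 s_cvx s0 s1.
suff : q^`().[1] <= C by rewrite q'R leNgt CN.
apply: Cbound => // x /andP[ax x1]; have xI : -1 <= x <= 1 by lra.
by rewrite -sq ?in_itv/= ?ax// ger0_norm ?s_ge0 ?s_le1.
Unshelve. all: by end_near.
Qed.
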